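(* Consider a sextuple of type $A(3k+1,0)$ with $k\ge0$, or of type $A(3k-1,0)$ with $k\ge1$. (i) Compatible $(-1)^k$-symmetric forms on it are unique up to isometric automorphism and multiplication by scalars: if $B_1,B_2$ are two compatible $(-1)^k$-symmetric forms, there are $0\ne c\in\mathbf k$ and an automorphism $\eta$ of the sextuple such that $B_2=c\,\eta^*B_1$. (ii) There are no compatible $(-1)^{k+1}$-symmetric forms on it. (iii) If $B$ is a compatible $\varepsilon$-symmetric form on it and $0\neq c\in\mathbf k$, then there is an automorphism $\eta$ of the sextuple with $\eta^*B=cB$ if and only if $c$ is a square in $\mathbf k$.
   Context: Standing assumptions: $\mathbf k$ is a perfect field with $\operatorname{char}\mathbf k\neq 2$; all vector spaces are finite-dimensional over $\mathbf k$. A sextuple $(V;C_i,I_i)$ in $V$ consists of subspaces $I_i\subseteq C_i\subseteq V$, $i=1,2,3$. An automorphism of the sextuple is a linear bijection $f:V\to V$ with $f(I_i)=I_i$, $f(C_i)=C_i$ for all $i$. For a bilinear form $B$, $(\eta^*B)(x,y)=B(\eta x,\eta y)$. For $\varepsilon=\pm1$, an $\varepsilon$-symmetric form is a bilinear form $B$ with $B(x,y)=\varepsilon B(y,x)$. A compatible $\varepsilon$-symmetric form for a sextuple is a non-degenerate $\varepsilon$-symmetric form $B$ on $V$ such that $C_i=I_i^{\perp}$ (with respect to $B$) for $i=1,2,3$. Type $A(3k+1,0)$, $k\ge0$: a sextuple in a space $V$ having a basis $(e_1,\dots,e_{k+1},f_1,\dots,f_k,g_1,\dots,g_k)$ such that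 $I_1=\langle e_1-f_1,\dots,e_k-f_k\rangle$, $I_2=\langle g_1,\dots,g_k\rangle$, $I_3=\langle f_1-g_1,\dots,f_k-g_k\rangle$, $C_1=\langle e_1,\dots,e_{k+1},f_1,\dots,f_k\rangle$, $C_2=\langle e_1,\dots,e_{k+1},g_1,\dots,g_k\rangle$, $C_3=\langle e_1,e_2-f_1,\dots,e_{k+1}-f_k,f_1-g_1,\dots,f_k-g_k\rangle$. Type $A(3k-1,0)$, $k\ge1$: a sextuple in a space $V$ having a basis $(e_2,\dots,e_k,f_1,\dots,f_k,g_1,\dots,g_k)$ such that $I_1=\langle f_1,f_2-e_2,\dots,f_k-e_k\rangle$, $I_2=\langle g_1,\dots,g_k\rangle$, $I_3=\langle f_1-g_1,\dots,f_k-g_k\rangle$, $C_1=\langle e_2,\dots,e_k,f_1,\dots,f_k\rangle$, $C_2=\langle e_2,\dots,e_k,g_1,\dots,g_k\rangle$, $C_3=\langle f_1-e_2,\dots,f_{k-1}-e_k,f_1-g_1,\dots,f_k-g_k\rangle$. *)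

(* Defs.v *)
From mathcomp Require Import all_boot all_order all_algebra separable.

Set Implicit Arguments.
Unset Strict Implicit.
Unset Printing Implicit Defensive.

Import GRing.Theory.
Local Open Scope ring_scope.

Definition perfect_field (K : fieldType) : Prop :=
  forall p : {poly K}, irreducible_poly p -> separable_poly p.

(* The indices i = 1, 2, 3 of a sextuple (V; C_i, I_i) are 0, 1, 2 : 'I_3. *)
Record sextuple (K : fieldType) (V : vectType K) := Sextuple {
  sextI : 'I_3 -> {vspace V};
  sextC : 'I_3 -> {vspace V};
  sextIC : forall i, (sextI i <= sextC i)%VS
}.

Definition sextuple_aut (K : fieldType) (V : vectType K)
    (S : sextuple V) (eta : 'End(V)) : Prop :=
  [/\ bijective eta,
      forall i, (eta @: sextI S i)%VS = sextI S i
    & forall i, (eta @: sextC S i)%VS = sextC S i].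

(* {hermitian V for eps & idfun} is the type of bilinear forms B with
   B x y = (-1) ^+ eps * B y x; eps = odd n thus gives the (-1)^n-symmetric
   forms. *)
Definition compatible (K : fieldType) (V : vectType K) (S : sextuple V)
    (eps : bool) (B : {hermitian V for eps & idfun}) : Prop :=
  nondegenerate B /\ forall i, sextC S i = orthov B (sextI S i).

(* In both types the families e, f, g carry the usual 1-based subscripts; their
   values at the subscripts that do not occur are irrelevant. *)

(* Type A(3k+1, 0): basis e_1 .. e_(k+1), f_1 .. f_k, g_1 .. g_k. *)
Definition type_A_3kp1 (K : fieldType) (V : vectType K) (k : nat)
    (S : sextuple V) : Prop :=
  exists e f g : nat -> V,
  let es := [seq e i | i <- index_iota 1 k.+2] in
  let fs := [seq f i | i <- index_iota 1 k.+1] in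
  let gs := [seq g i | i <- index_iota 1 k.+1] in
  let f_g := [seq f i - g i | i <- index_iota 1 k.+1] in
  [/\ basis_of fullv (es ++ fs ++ gs),
      [/\ sextI S 0 = <<[seq e i - f i | i <- index_iota 1 k.+1]>>%VS,
          sextI S 1 = <<gs>>%VS
        & sextI S 2 = <<f_g>>%VS]
    & [/\ sextC S 0 = <<es ++ fs>>%VS,
          sextC S 1 = <<es ++ gs>>%VS
        & sextC S 2 =
            <<e 1%N :: [seq e i.+1 - f i | i <- index_iota 1 k.+1] ++ f_g>>%VS]].

(* Type A(3k-1, 0), for k >= 1: basis e_2 .. e_k, f_1 .. f_k, g_1 .. g_k. *)
Definition type_A_3km1 (K : fieldType) (V : vectType K) (k : nat)
    (S : sextuple V) : Prop :=
  exists e f g : nat -> V,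
  let es := [seq e i | i <- index_iota 2 k.+1] in
  let fs := [seq f i | i <- index_iota 1 k.+1] in
  let gs := [seq g i | i <- index_iota 1 k.+1] in
  let f_g := [seq f i - g i | i <- index_iota 1 k.+1] in
  [/\ basis_of fullv (es ++ fs ++ gs),
      [/\ sextI S 0 = <<f 1%N :: [seq f i - e i | i <- index_iota 2 k.+1]>>%VS,
          sextI S 1 = <<gs>>%VS
        & sextI S 2 = <<f_g>>%VS]
    & [/\ sextC S 0 = <<es ++ fs>>%VS,
          sextC S 1 = <<es ++ gs>>%VS
        & sextC S 2 =
            <<[seq f i - e i.+1 | i <- index_iota 1 k] ++ f_g>>%VS]].

(* Main.v *)
From HB Require Import structures.
Require Import Defs.
From mathcomp Require Import all_boot all_order all_algebra separable ring zify.

Import GRing.Theory.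
Local Open Scope ring_scope.

(** Both types of sextuples are local: an endomorphism of the sextuple, that is
    a linear map sending every I_i and every C_i into itself, is a scalar plus
    a nilpotent map. In the basis e, f, g such a map is block diagonal, because
    <e>, <f> and <g> arise from the I_i and C_i by sums and intersections. The
    generators e_i - f_i and f_i - g_i (up to sign) of I_1 and I_3 force the
    three blocks to have the same entries m_(i,j) at common indices. The
    generators e_(i+1) - f_i of C_3 (again up to sign) force
    m_(i+1,j+1) = m_(i,j), and the one
    generator that is a basis vector, e_1 of C_3 in the first type and f_1 of
    I_1 in the second, forces m_(1,j) = 0 for j > 1. So m is a triangular
    Toeplitz matrix (local_3kp1, local_3km1).

    Locality alone gives (i) and (iii). If B1 and B2 are compatible, the map h
    with B2(x,y) = B1(x, h y) is an endomorphism of the sextuple, because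
    I_i = C_i^perp for both forms, and it is self-adjoint for B1 because both
    forms have the same symmetry. By locality h = c + nilpotent with c nonzero,
    so that h / c has a square root r among the polynomials in h, as the
    characteristic is not 2. Such an r is again self-adjoint and again an
    endomorphism of the sextuple, and B2(x,y) = c B1(x, r r y) =
    c B1(r x, r y) (compatible_form_unique). If B(eta x, eta y) = c B(x, y) and
    eta = d + n with n nilpotent, then an eigenvector v of eta satisfies
    d B(v, n y) = (c - d^2) B(v, y) for all y, and iterating this gives
    c = d^2. Conversely d times the identity multiplies B by d^2
    (compatible_similitude).

    For (ii), the orthogonality relations make the Gram entries
    b_(i,j) = B(e_(i+1), e_(j+1)) a Pascal type array:
    b_(i,j) = b_(i,j+1) + b_(i+1,j), with zeros b_(0,j) for j < k. Hence
    b_(k,0) = (-1)^k b_(0,k). If B is (-1)^(k+1)-symmetric, the corner b_(0,k)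
    vanishes, and then e_1 lies in the radical of B. For the second type the
    array is B(f_(i+1), f_(j+1)), bordered by entries that involve g, and the
    radical contains g_1 (no_compatible_3kp1, no_compatible_3km1). *)

(** * Endomorphisms of a sextuple *)

Definition sextuple_endo {K : fieldType} {V : vectType K} (S : sextuple V)
    (h : 'End(V)) : Prop :=
  forall i, (h @: sextI S i <= sextI S i)%VS /\ (h @: sextC S i <= sextC S i)%VS.

(** Nilpotency is expressed pointwise, so that it does not need a ring structure
    on the endomorphisms. *)
Definition scalar_plus_nilpotent {K : fieldType} {V : vectType K}
    (h : 'End(V)) (c : K) : Prop :=
  exists m, forall v, iter m (h - c *: \1)%VF v = 0.

Definition local_sextuple {K : fieldType} {V : vectType K} (S : sextuple V) :=
  forall h : 'End(V), sextuple_endo S h -> exists c, scalar_plus_nilpotent h c.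

(** An injective endomorphism maps each subspace onto itself by equality of
    dimensions. *)
Lemma sextuple_endo_inj_aut {K : fieldType} {V : vectType K} (S : sextuple V)
    (h : 'End(V)) : sextuple_endo S h -> injective h -> sextuple_aut S h.
Proof.
move=> hS h_inj; have ker0 : lker h == 0%VS by apply/lker0P.
have img U : (h @: U <= U)%VS -> (h @: U)%VS = U.
  move=> hU; apply/eqP; rewrite eqEdim hU limg_dim_eq ?leqnn //.
  by rewrite (eqP ker0) capv0.
split=> [|i|i]; try by case: (hS i) => ? ?; apply: img.
by exists (h^-1)%VF; [exact: lker0_lfunK | exact: lker0_lfunVK].
Qed.

Lemma sextuple_aut_endo {K : fieldType} {V : vectType K} (S : sextuple V)
    (h : 'End(V)) : sextuple_aut S h -> sextuple_endo S h.
Proof. by case=> _ hI hC i; rewrite hI hC !subvv. Qed.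

Lemma limg_subvP {K : fieldType} {V : vectType K} (h : 'End(V))
    (U : {vspace V}) :
  reflect (forall v, v \in U -> h v \in U) (h @: U <= U)%VS.
Proof.
apply: (iffP subvP) => [hU v vU|hU _ /memv_imgP[v vU ->]]; last exact: hU.
by apply/hU/memv_img.
Qed.

Lemma sextuple_endo_comp_add {K : fieldType} {V : vectType K} (S : sextuple V)
    (f h : 'End(V)) (a : K) : sextuple_endo S f -> sextuple_endo S h ->
  sextuple_endo S (f \o h + a *: \1)%VF.
Proof.
move=> fS hS i; have [[fI fC] [hI hC]] := (fS i, hS i).
by split; apply/limg_subvP => v vU;
  rewrite add_lfunE scale_lfunE id_lfunE comp_lfunE memvD ?memvZ //;
  apply/(limg_subvP f); rewrite //; apply/(limg_subvP h).
Qed.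

Lemma sextuple_endo0 {K : fieldType} {V : vectType K} (S : sextuple V) :
  sextuple_endo S 0.
Proof.
by move=> i; split; apply/limg_subvP => v _; rewrite zero_lfunE mem0v.
Qed.

Lemma sextuple_endo_shift {K : fieldType} {V : vectType K} (S : sextuple V)
    (h : 'End(V)) (c : K) :
  sextuple_endo S h -> sextuple_endo S (h - c *: \1)%VF.
Proof.
have endo1 : sextuple_endo S (\1)%VF.
  by move=> i; split; apply/limg_subvP => v; rewrite id_lfunE.
move=> hS; have := sextuple_endo_comp_add S _ _ (- c) endo1 hS.
by rewrite comp_lfun1l scaleNr.
Qed.

(** * Square roots of operators with a single nonzero eigenvalue *)

(** Hensel lifting of the square root 1 of X / c at the point X = c: a root p
    modulo (X - c)^(m+1) has p(c) <> 0, so that adding a suitable multiple of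
    (X - c)^(m+1) corrects the next coefficient. *)
Lemma poly_sqrt_mod {K : fieldType} (c : K) (m : nat) :
  2%N \notin [pchar K] -> c != 0 ->
  exists p q : {poly K}, p ^+ 2 = c^-1%:P * 'X + ('X - c%:P) ^+ m.+1 * q.
Proof.
move=> char2 c0; elim: m => [|m [p [q pq]]].
  exists 1, (- c^-1)%:P.
  have cc : c^-1%:P * c%:P = 1 :> {poly K} by rewrite -polyCM mulVf.
  by rewrite polyCN; ring: cc.
set u := 'X - c%:P in pq *.
have pc : p.[c] ^+ 2 = 1.
  by rewrite -horner_exp pq !hornerE subrr expr0n /= mul0r addr0 mulVf.
have two0 : 2%:R != 0 :> K by move: char2; rewrite inE.
have pc0 : p.[c] != 0 by rewrite -sqrf_eq0 pc oner_eq0.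
(* This t makes q + 2 t p vanish at c, which gains one more factor X - c. *)
set t := - q.[c] / (2%:R * p.[c]).
have /factor_theorem[q' q'E] : root (q + 2%:R%:P * t%:P * p) c.
  rewrite /root hornerD !hornerM !hornerC /t; apply/eqP; field.
  by rewrite pc0.
exists (p + t%:P * u ^+ m.+1), (q' + t%:P ^+ 2 * u ^+ m).
have -> : (p + t%:P * u ^+ m.+1) ^+ 2 =
  p ^+ 2 + u ^+ m.+1 * (2%:R%:P * t%:P * p) + t%:P ^+ 2 * u ^+ m.+1 ^+ 2.
  by rewrite polyC_natr; ring.
have qE : q = q' * u - 2%:R%:P * t%:P * p by rewrite -q'E addrK.
by rewrite pq qE !exprS; ring.
Qed.

(** The square root is a polynomial in h. The predicate P records this: it holds
    for r as soon as it is stable under the Horner step f |-> h f + a, which is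
    how self-adjointness and stability of subspaces pass from h to r. The
    polynomial is a root of X / c modulo a power of X - c that kills h. *)
Lemma sqrt_in_generated_algebra {K : fieldType} {V : vectType K} (h : 'End(V)) (c : K)
    (P : 'End(V) -> Prop) :
  (0 < dim V)%N -> 2%N \notin [pchar K] -> c != 0 ->
  scalar_plus_nilpotent h c ->
  P 0 -> (forall f a, P f -> P (h \o f + a *: \1)%VF) ->
  exists2 r : 'End(V), P r & (forall v, h v = c *: r (r v)).
Proof.
move=> V0 char2 c0 [m nil] P0 PS.
pose A := lfun_algType V0; pose a : A := h.
have mulE (f g : A) v : (f * g : A) v = g (f v) by rewrite -comp_lfunE.
have [p [q pq]] := poly_sqrt_mod c m char2 c0.
have nilA : (a - c%:A) ^+ m = 0 :> A.
  apply/lfunP => v; rewrite zero_lfunE -[RHS](nil v).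
  elim: m {nil pq} v => [|m IH] v; first by rewrite expr0 id_lfunE.
  by rewrite exprSr mulE IH.
exists (horner_alg a p).
  elim/poly_ind: p {pq} => [|p b IH]; first by rewrite rmorph0.
  have -> : horner_alg a (p * 'X + b%:P) = (h \o horner_alg a p + b *: \1)%VF.
    by rewrite rmorphD rmorphM /= horner_algX horner_algC.
  exact: PS.
move=> v; rewrite -mulE -expr2.
have -> : horner_alg a p ^+ 2 = c^-1 *: a :> A.
  rewrite -rmorphXn /= pq rmorphD !rmorphM /= rmorphXn rmorphB /=.
  by rewrite !horner_algX !horner_algC exprS nilA mulr0 mul0r addr0 mulr_algl.
by rewrite scale_lfunE scalerA mulfV // scale1r.
Qed.

(** * Non-degenerate forms and duality *)

Lemma herm_eq0_sym {K : fieldType} {V : vectType K} {eps : bool}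
    (B : {hermitian V for eps & idfun}) x y : B x y = 0 -> B y x = 0.
Proof. by move=> xy0; rewrite hermC /= xy0 mulr0. Qed.

Lemma nondegenerate_eq0 {K : fieldType} {V : vectType K} {eps : bool}
    (B : {hermitian V for eps & idfun}) y :
  nondegenerate B -> (forall x, B x y = 0) -> y = 0.
Proof.
move=> /eqP ndB By0; apply/eqP; rewrite -memv0 -ndB.
by apply/mem_orthovP => x _; apply: herm_eq0_sym.
Qed.

(** The map y |-> B(-, y) into the dual space. Turning it into a morphism here
    lets the representation of functionals and the transition between two forms
    be compositions of linear maps. *)
Lemma form_dual {K : fieldType} {V : vectType K} {eps : bool}
    (B : {hermitian V for eps & idfun}) :
  exists E : 'Hom(V, 'Hom(V, K^o)), forall x y, E y x = B x y.
Proof.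
pose dual (y : V) := linfun (applyr B y : V -> K^o).
have dual_lin : linear dual.
  move=> a y z; apply/lfunP => x.
  by rewrite add_lfunE scale_lfunE !lfunE /= linearPr.
pose dualL : {linear V -> 'Hom(V, K^o)} :=
  HB.pack dual (GRing.isLinear.Build _ _ _ _ _ dual_lin).
by exists (linfun dualL) => x y; rewrite !lfunE.
Qed.

(** For a non-degenerate form y |-> B(-, y) is injective, hence bijective since
    V and its dual have the same dimension. *)
Lemma form_representation {K : fieldType} {V : vectType K} {eps : bool}
    (B : {hermitian V for eps & idfun}) : nondegenerate B ->
  exists D : 'Hom('Hom(V, K^o), V),
    forall (phi : 'Hom(V, K^o)) x, B x (D phi) = phi x.
Proof.
move=> ndB; have [E EE] := form_dual B.
have ker0 : lker E == 0%VS.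
  rewrite -subv0; apply/subvP => y; rewrite memv_ker memv0 => /eqP y0.
  by apply/eqP/(nondegenerate_eq0 B) => // x; rewrite -EE y0 zero_lfunE.
have img : limg E = fullv.
  apply/eqP; rewrite eqEdim subvf limg_dim_eq ?(eqP ker0) ?capv0 //.
  by rewrite !dimvf /dim /= muln1.
by exists E^-1%VF => phi x; rewrite -EE limg_lfunVK // img memvf.
Qed.

(** A coordinate of x - proj_U(x), where proj_U is a projection onto U, that does
    not vanish. *)
Lemma functional_separation {K : fieldType} {V : vectType K} (U : {vspace V})
    (x : V) : x \notin U ->
  exists2 phi : 'Hom(V, K^o), (forall u, u \in U -> phi u = 0) & phi x != 0.
Proof.
move=> xU; pose pr := (\1 - projv U)%VF.
have prE v : pr v = v - projv U v by rewrite add_lfunE opp_lfunE id_lfunE.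
have prx : pr x != 0.
  by rewrite prE subr_eq0; apply: contraNneq xU => ->; apply: memv_proj.
have /existsP[i xi] : [exists i, coord (vbasis {:V}) i (pr x) != 0].
  rewrite -negb_forall; apply: contra prx => /forallP x0.
  rewrite (coord_vbasis (memvf (pr x))) big1 // => i _.
  by rewrite (eqP (x0 i)) scale0r.
exists (linfun (coord (vbasis {:V}) i : V -> K^o) \o pr)%VF => [u uU|].
  by rewrite comp_lfunE prE projv_id // subrr linear0.
by rewrite comp_lfunE lfunE.
Qed.

(** A vector outside U is separated from U by a functional, and that functional
    is B(-, y) for some y in the orthogonal of U. *)
Lemma orthovK {K : fieldType} {V : vectType K} {eps : bool}
    (B : {hermitian V for eps & idfun}) (U : {vspace V}) :
  nondegenerate B -> orthov B (orthov B U) = U.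
Proof.
move=> ndB; have [D DE] := form_representation B ndB.
apply/eqP; rewrite eqEsubv; apply/andP; split; apply/subvP => x; last first.
  by move=> xU; apply/mem_orthovP => y /mem_orthovP yU; apply/herm_eq0_sym/yU.
apply: contraLR => /functional_separation[phi phiU phix].
apply/mem_orthovPn; exists (D phi); last by rewrite DE.
by apply/mem_orthovP => u uU; apply: herm_eq0_sym; rewrite DE phiU.
Qed.

Lemma compatible_orthI {K : fieldType} {V : vectType K} {S : sextuple V}
    {eps : bool} {B : {hermitian V for eps & idfun}} (i : 'I_3) x y :
  compatible S B -> x \in sextC S i -> y \in sextI S i -> B x y = 0.
Proof. by case=> _ -> /mem_orthovP; apply. Qed.

(** * Compatible forms on local sextuples *)

(** The relation B2(x, y) = B1(x, h y) turns the B2-orthogonality of I_i and C_i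
    into B1-orthogonality of h(I_i) to C_i and of h(C_i) to I_i. *)
Lemma transition_endo {K : fieldType} {V : vectType K} (S : sextuple V)
    (eps : bool) (B1 B2 : {hermitian V for eps & idfun}) (h : 'End(V)) :
  compatible S B1 -> compatible S B2 -> (forall x y, B2 x y = B1 x (h y)) ->
  sextuple_endo S h.
Proof.
move=> cB1 cB2 hE i; have [[nd1 C1] [nd2 C2]] := (cB1, cB2).
split; apply/limg_subvP => y yU.
  rewrite -(orthovK B1 (sextI S i)) // -C1; apply/mem_orthovP => x xC.
  by apply: herm_eq0_sym; rewrite -hE; apply: compatible_orthI cB2 xC yU.
rewrite C1; apply/mem_orthovP => x xI; apply: herm_eq0_sym; rewrite -hE.
by apply: herm_eq0_sym; apply: compatible_orthI cB2 yU xI.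
Qed.

(** An injective map with a vanishing iterate lives on the zero space. *)
Lemma nilpotent_ker_neq0 {K : fieldType} {V : vectType K} (n : 'End(V)) m :
  (0 < dim V)%N -> (forall v, iter m n v = 0) ->
  exists2 v, v != 0 & n v = 0.
Proof.
move=> V0 nil; have [ker0|kerN0] := eqVneq (lker n) 0%VS.
  have inj : injective n by apply/lker0P/eqP.
  have fullN0 : {:V}%VS != 0%VS by rewrite -dimv_eq0 dimvf -lt0n.
  case/negP: fullN0; rewrite -subv0; apply/subvP => v _; rewrite memv0; apply/eqP.
  elim: m nil => [|m IH] nil; first exact: nil.
  by apply: IH => w; apply: inj; rewrite linear0; apply: nil.
exists (vpick (lker n)); rewrite ?vpick0 //.
by apply/eqP; rewrite -memv_ker memv_pick.
Qed.

(** The transition map h between the forms is self-adjoint, and its normalised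
    square root r satisfies c B1(r x, r y) = c B1(x, r r y) = B1(x, h y). *)
Lemma compatible_form_unique {K : fieldType} {V : vectType K} (S : sextuple V)
    (eps : bool) (B1 B2 : {hermitian V for eps & idfun}) :
  2%N \notin [pchar K] -> (0 < dim V)%N -> local_sextuple S ->
  compatible S B1 -> compatible S B2 ->
  exists c : K, exists eta : 'End(V),
    [/\ c != 0, sextuple_aut S eta
      & forall x y, B2 x y = c * B1 (eta x) (eta y)].
Proof.
move=> char2 V0 locS cB1 cB2; have [[nd1 _] [nd2 _]] := (cB1, cB2).
have [D DE] := form_representation B1 nd1.
have [E EE] := form_dual B2.
have [h hE] : exists h : 'End(V), forall x y, B2 x y = B1 x (h y).
  by exists (D \o E)%VF => x y; rewrite comp_lfunE DE EE.
have h_sym x y : B1 (h x) y = B1 x (h y).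
  by rewrite -hE (hermC B2 x y) hE -hermC.
have h_inj : injective h.
  move=> y z yz; apply/eqP; rewrite -subr_eq0.
  apply/eqP/(nondegenerate_eq0 B2) => // x.
  by rewrite hE linearB /= yz subrr linear0r.
have hS : sextuple_endo S h by apply: transition_endo cB1 cB2 hE.
have [c hc] := locS h hS.
have [m nil] := hc; have [v v0 hv] := nilpotent_ker_neq0 _ m V0 nil.
have c0 : c != 0.
  apply: contra v0 => /eqP c0; apply/eqP/h_inj; rewrite linear0.
  by move: hv; rewrite c0 scale0r subr0.
(* Commutation with h is what makes self-adjointness stable under the step
   f |-> h f + a. *)
pose P f := [/\ sextuple_endo S f, forall x y, B1 (f x) y = B1 x (f y)
   & forall x, f (h x) = h (f x)].
have P0 : P 0.
  split=> [|x y|x]; first exact: sextuple_endo0.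
    by rewrite !zero_lfunE linear0l linear0r.
  by rewrite !zero_lfunE linear0.
have PS f a : P f -> P (h \o f + a *: \1)%VF.
  case=> fS f_sym fh; split=> [|x y|x]; first exact: sextuple_endo_comp_add.
    rewrite !add_lfunE !scale_lfunE !id_lfunE !comp_lfunE.
    by rewrite linearDl linearDr linearZl_LR linearZr_LR /= h_sym f_sym fh.
  by rewrite !add_lfunE !scale_lfunE !id_lfunE !comp_lfunE linearD linearZ fh.
have [r [rS r_sym _] rr] := sqrt_in_generated_algebra h c P V0 char2 c0 hc P0 PS.
have r_inj : injective r.
  by move=> x y rxy; apply: h_inj; rewrite !rr rxy.
exists c, r; split=> //; first exact: sextuple_endo_inj_aut.
by move=> x y; rewrite hE rr r_sym linearZr_LR.
Qed.

(** The only eigenvalue d of a similitude eta pairs with itself under B, so that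
    the multiplier has to be d * d. *)
Lemma compatible_similitude {K : fieldType} {V : vectType K} (S : sextuple V)
    (eps : bool) (B : {hermitian V for eps & idfun}) (c : K) :
  (0 < dim V)%N -> local_sextuple S -> compatible S B -> c != 0 ->
  (exists eta : 'End(V),
     sextuple_aut S eta /\ forall x y, B (eta x) (eta y) = c * B x y)
  <-> exists d : K, c = d ^+ 2.
Proof.
move=> V0 locS [ndB _] c0; split=> [[eta [etaS etaB]]|[d cE]].
  have [d [m nil]] := locS eta (sextuple_aut_endo _ _ etaS).
  have [v v0 nv] := nilpotent_ker_neq0 _ m V0 nil.
  have shiftE w : (eta - d *: \1)%VF w = eta w - d *: w.
    by rewrite add_lfunE opp_lfunE scale_lfunE id_lfunE.
  have etav : eta v = d *: v.
    by apply/eqP; move: nv; rewrite shiftE => /eqP; rewrite subr_eq0.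
  exists d; apply/eqP; apply: contraNT v0 => cd; apply/eqP.
  apply: (nondegenerate_eq0 B) => // y; apply: herm_eq0_sym.
  have step w : d * B v ((eta - d *: \1)%VF w) = (c - d ^+ 2) * B v w.
    rewrite shiftE linearBr linearZr_LR /= mulrBr.
    by rewrite mulrBl -etaB etav linearZl_LR /= expr2 mulrA.
  (* As n^m = 0, iterating the previous identity leaves no room for
     c <> d^2. *)
  have pow j w : d ^+ j * B v (iter j (eta - d *: \1)%VF w)
      = (c - d ^+ 2) ^+ j * B v w.
    elim: j w => [|j IH] w; first by rewrite !mul1r.
    by rewrite iterSr exprSr -mulrA mulrCA IH mulrCA step mulrA -exprSr.
  have /eqP := pow m y; rewrite nil linear0r mulr0 eq_sym mulf_eq0.
  by rewrite expf_eq0 subr_eq0 (negPf cd) andbF => /eqP.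
have d0 : d != 0 by move: c0; rewrite cE expf_eq0.
exists (d *: \1)%VF; split.
  apply: sextuple_endo_inj_aut => [|x y].
    have := sextuple_endo_comp_add S _ _ d (sextuple_endo0 S) (sextuple_endo0 S).
    by rewrite comp_lfun0l add0r.
  by rewrite !lfunE /= !lfunE => /(scalerI d0).
by move=> x y; rewrite cE !lfunE /= !lfunE linearZl_LR linearZr_LR /= mulrA expr2.
Qed.

(** * Compatible forms of the wrong symmetry *)

(** The vanishing first row makes b zero strictly above the antidiagonal
    i + j = k; the recursion at the entry just above it then says that
    consecutive antidiagonal entries are opposite. *)
Lemma pascal_antidiagonal {K : pzRingType} (k : nat) (b : nat -> nat -> K) :
  (forall i j, (i < k)%N -> (j < k)%N -> b i j = b i j.+1 + b i.+1 j) ->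
  (forall j, (j < k)%N -> b 0 j = 0) ->
  b k 0 = (-1) ^+ k * b 0 k.
Proof.
move=> rec b0; have rec' i j : (i < k)%N -> (j < k)%N -> b i.+1 j = b i j - b i j.+1.
  by move=> ik jk; rewrite (rec i) // addrC addKr.
have zero i j : (i + j < k)%N -> b i j = 0.
  elim: i j => [|i IH] j ijk; first exact: b0.
  rewrite rec' ?IH ?subr0 //; lia.
have diag i : (i <= k)%N -> b i (k - i)%N = (-1) ^+ i * b 0 k.
  elim: i => [|i IH] ik; first by rewrite subn0 mul1r.
  rewrite rec' //; last lia.
  rewrite zero; last lia.
  have -> : (k - i.+1).+1 = (k - i)%N by lia.
  by rewrite IH 1?ltnW // sub0r exprS mulN1r mulNr.
by rewrite -diag // subnn.
Qed.

(** The symmetry of B gives B(y, x) = (-1)^(k+1) B(x, y), so that 2 B(x, y)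
    vanishes. *)
Lemma opposite_sign_entry_eq0 {K : fieldType} {V : vectType K} (k : nat)
    (B : {hermitian V for odd k.+1 & idfun}) x y :
  2%N \notin [pchar K] -> B y x = (-1) ^+ k * B x y -> B x y = 0.
Proof.
move=> char2; rewrite hermC /= signrN signr_odd mulNr => /eqP.
rewrite eq_sym -addr_eq0 -mulr2n -mulr_natl !mulf_eq0 signr_eq0.
by move: char2; rewrite inE /= => /negPf -> /eqP.
Qed.

Lemma mem_family {T : eqType} (x : nat -> T) (a b i : nat) :
  (a <= i < b)%N -> x i \in [seq x j | j <- index_iota a b].
Proof. by move=> ab; apply: map_f; rewrite mem_index_iota. Qed.

Lemma basis_vector_not_radical {K : fieldType} {V : vectType K} {eps : bool}
    (B : {hermitian V for eps & idfun}) (X : seq V) v :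
  nondegenerate B -> basis_of fullv X -> v \in X ->
  (forall x, x \in X -> B v x = 0) -> False.
Proof.
move=> ndB bX vX vX0; have [_ /free_not0] := andP bX.
move/(_ v vX)/eqP; apply; apply: (nondegenerate_eq0 B) => // x.
apply: herm_eq0_sym; suff: (<<X>> <= orthov B <[v]>)%VS.
  rewrite (span_basis bX) => /subvP/(_ x (memvf x)).
  by rewrite mem_orthov1 => /eqP/herm_eq0_sym.
by apply/span_subvP => y yX; rewrite mem_orthov1; apply/eqP/herm_eq0_sym/vX0.
Qed.

(** The corner of the Pascal array is B(e_1, e_(k+1)), the only Gram entry that
    keeps e_1 out of the radical. *)
Lemma no_compatible_3kp1 {K : fieldType} {V : vectType K} (k : nat)
    (S : sextuple V) (B : {hermitian V for odd k.+1 & idfun}) :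
  2%N \notin [pchar K] -> type_A_3kp1 k S -> ~ compatible S B.
Proof.
move=> char2 [e [f [g]]] [bV [I1 I2 I3] [C1 C2 C3]] cB.
have oCI i x y := @compatible_orthI _ _ _ _ _ i x y cB.
have eC1 i : (1 <= i < k.+2)%N -> e i \in sextC S 0.
  by move=> ik; rewrite C1 memv_span // mem_cat mem_family.
have fC1 i : (1 <= i < k.+1)%N -> f i \in sextC S 0.
  by move=> ik; rewrite C1 memv_span // mem_cat mem_family ?orbT.
have eC2 i : (1 <= i < k.+2)%N -> e i \in sextC S 1.
  by move=> ik; rewrite C2 memv_span // mem_cat mem_family.
have gC2 i : (1 <= i < k.+1)%N -> g i \in sextC S 1.
  by move=> ik; rewrite C2 memv_span // mem_cat mem_family ?orbT.
have e1C3 : e 1%N \in sextC S 2.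
  by rewrite C3 memv_span // mem_head.
have efC3 i : (1 <= i < k.+1)%N -> e i.+1 - f i \in sextC S 2.
  move=> ik; rewrite C3 memv_span // inE mem_cat.
  by rewrite (mem_family (fun i => e i.+1 - f i)) ?orbT.
have fgC3 i : (1 <= i < k.+1)%N -> f i - g i \in sextC S 2.
  move=> ik; rewrite C3 memv_span // inE mem_cat.
  by rewrite (mem_family (fun i => f i - g i)) ?orbT.
have efI1 i : (1 <= i < k.+1)%N -> e i - f i \in sextI S 0.
  by move=> ik; rewrite I1 memv_span // (mem_family (fun i => e i - f i)).
have gI2 i : (1 <= i < k.+1)%N -> g i \in sextI S 1.
  by move=> ik; rewrite I2 memv_span // mem_family.
have fgI3 i : (1 <= i < k.+1)%N -> f i - g i \in sextI S 2.
  by move=> ik; rewrite I3 memv_span // (mem_family (fun i => f i - g i)).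
have e1g j : (1 <= j < k.+1)%N -> B (e 1) (g j) = 0.
  by move=> jk; apply: (oCI 1); rewrite ?eC2 ?gI2.
have e1f j : (1 <= j < k.+1)%N -> B (e 1) (f j) = 0.
  move=> jk; have := oCI _ _ _ e1C3 (fgI3 j jk).
  by rewrite linearBr /= e1g // subr0.
have e1e j : (1 <= j < k.+1)%N -> B (e 1) (e j) = 0.
  move=> jk; have := oCI _ _ _ (eC1 1%N isT) (efI1 j jk).
  by rewrite linearBr /= e1f // subr0.
have e1ek : B (e 1) (e k.+1) = 0.
  apply: opposite_sign_entry_eq0 => //.
  apply: (pascal_antidiagonal k (fun i j => B (e i.+1) (e j.+1))); last first.
    by move=> j jk; apply: e1e.
  move=> i' j' ik jk; set i := i'.+1; set j := j'.+1.
  have {}ik : (1 <= i < k.+1)%N by [].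
  have {}jk : (1 <= j < k.+1)%N by [].
  have ik2 : (1 <= i < k.+2)%N by lia.
  have jk2 : (1 <= j < k.+2)%N by lia.
  have jk3 : (1 <= j.+1 < k.+2)%N by lia.
  have ik3 : (1 <= i.+1 < k.+2)%N by lia.
  (* All entries reduce to B(f_i, f_j), B(f_i, g_j) and B(g_i, f_j), which are
     related by the isotropy of f_i - g_i and f_j - g_j. *)
  have ee : B (e i) (e j) = B (e i) (f j).
    by apply: subr0_eq; rewrite -linearBr; apply: oCI (eC1 i ik2) (efI1 j jk).
  have ef : B (e i) (f j) = B (f i) (f j).
    apply: subr0_eq; rewrite -linearBl.
    exact/herm_eq0_sym/(oCI _ _ _ (fC1 j jk) (efI1 i ik)).
  have ee1 : B (e i) (e j.+1) = B (f i) (e j.+1).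
    apply: subr0_eq; rewrite -linearBl.
    exact/herm_eq0_sym/(oCI _ _ _ (eC1 j.+1 jk3) (efI1 i ik)).
  have e1e' : B (e i.+1) (e j) = B (e i.+1) (f j).
    by apply: subr0_eq; rewrite -linearBr; apply: oCI (eC1 i.+1 ik3) (efI1 j jk).
  have e1g' : B (e i.+1) (g j) = 0 by apply: oCI (eC2 i.+1 ik3) (gI2 j jk).
  have ge1 : B (g i) (e j.+1) = 0.
    by apply/herm_eq0_sym/(oCI _ _ _ (eC2 j.+1 jk3) (gI2 i ik)).
  have gg : B (g i) (g j) = 0 by apply: oCI (gC2 i ik) (gI2 j jk).
  have := oCI _ _ _ (efC3 i ik) (fgI3 j jk).
  have := herm_eq0_sym B _ _ (oCI _ _ _ (efC3 j jk) (fgI3 i ik)).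
  have := oCI _ _ _ (fgC3 i ik) (fgI3 j jk).
  rewrite !linearBr !linearBl /= ee ef ee1 e1e' e1g' ge1 gg !subr0.
  move=> /subr0_eq fg /subr0_eq -> /subr0_eq /(canRL (subrK _)) ->.
  by rewrite fg; ring.
apply: (basis_vector_not_radical B _ (e 1) _ bV); first by case: cB.
  by rewrite mem_cat mem_family.
move=> x; rewrite !mem_cat => /or3P[] /mapP[j]; rewrite mem_index_iota => jk ->.
- by have [->//|jN] := eqVneq j k.+1; apply: e1e; lia.
- exact: e1f.
- exact: e1g.
Qed.

(** Here e_1 and e_(k+1) are missing, so the row and the column of index k of the
    Pascal array B(f_(i+1), f_(j+1)) are filled with B(f_(i+1) - g_(i+1), f_k)
    and B(f_k, f_(j+1) - g_(j+1)), the values that the recursion dictates. The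
    corner B(f_1 - g_1, f_k) is up to sign B(g_1, f_k), the only Gram entry that
    keeps g_1 out of the radical. *)
Lemma no_compatible_3km1 {K : fieldType} {V : vectType K} (k : nat)
    (S : sextuple V) (B : {hermitian V for odd k.+1 & idfun}) :
  2%N \notin [pchar K] -> (0 < k)%N -> type_A_3km1 k S -> ~ compatible S B.
Proof.
move=> char2 k0 [e [f [g]]] [bV [I1 I2 I3] [C1 C2 C3]] cB.
have oCI i x y := @compatible_orthI _ _ _ _ _ i x y cB.
have fC1 i : (1 <= i < k.+1)%N -> f i \in sextC S 0.
  by move=> ik; rewrite C1 memv_span // mem_cat mem_family ?orbT.
have eC2 i : (2 <= i < k.+1)%N -> e i \in sextC S 1.
  by move=> ik; rewrite C2 memv_span // mem_cat mem_family.
have gC2 i : (1 <= i < k.+1)%N -> g i \in sextC S 1.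
  by move=> ik; rewrite C2 memv_span // mem_cat mem_family ?orbT.
have feC3 i : (1 <= i < k)%N -> f i - e i.+1 \in sextC S 2.
  move=> ik; rewrite C3 memv_span // mem_cat.
  by rewrite (mem_family (fun i => f i - e i.+1)).
have fgC3 i : (1 <= i < k.+1)%N -> f i - g i \in sextC S 2.
  move=> ik; rewrite C3 memv_span // mem_cat.
  by rewrite (mem_family (fun i => f i - g i)) ?orbT.
have f1I1 : f 1%N \in sextI S 0 by rewrite I1 memv_span // mem_head.
have feI1 i : (2 <= i < k.+1)%N -> f i - e i \in sextI S 0.
  move=> ik; rewrite I1 memv_span // inE.
  by rewrite (mem_family (fun i => f i - e i)) ?orbT.
have gI2 i : (1 <= i < k.+1)%N -> g i \in sextI S 1.
  by move=> ik; rewrite I2 memv_span // mem_family.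
have fgI3 i : (1 <= i < k.+1)%N -> f i - g i \in sextI S 2.
  by move=> ik; rewrite I3 memv_span // (mem_family (fun i => f i - g i)).
have f1f j : (1 <= j < k.+1)%N -> B (f 1) (f j) = 0.
  by move=> jk; apply/herm_eq0_sym/(oCI _ _ _ (fC1 j jk) f1I1).
have shift i j : (1 <= i < k.+1)%N -> (1 <= j < k)%N ->
    B (f i - g i) (f j) = B (f i) (f j.+1).
  move=> ik jk.
  have jk2 : (2 <= j.+1 < k.+1)%N by lia.
  have -> : B (f i - g i) (f j) = B (f i - g i) (e j.+1).
    apply: subr0_eq; rewrite -linearBr.
    exact/herm_eq0_sym/(oCI _ _ _ (feC3 j jk) (fgI3 i ik)).
  rewrite linearBl /= [B (g i) _]herm_eq0_sym ?subr0;
    last exact: oCI (eC2 _ jk2) (gI2 i ik).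
  by apply/esym/subr0_eq; rewrite -linearBr; apply: oCI (fC1 i ik) (feI1 _ jk2).
have shift' i j : (1 <= i < k)%N -> (1 <= j < k.+1)%N ->
    B (f i) (f j - g j) = B (f i.+1) (f j).
  by move=> ik jk; rewrite hermC shift // -hermC.
pose b i j := if (i < k)%N then
    if (j < k)%N then B (f i.+1) (f j.+1) else B (f i.+1 - g i.+1) (f k)
  else B (f k) (f j.+1 - g j.+1).
have bS i j : (i < k)%N -> (j < k)%N -> b i j.+1 = B (f i.+1 - g i.+1) (f j.+1).
  move=> ik jk; rewrite /b ik; case: ltnP => jk'; first by rewrite shift.
  by congr (B _ (f _)); lia.
have bS' i j : (i < k)%N -> (j < k)%N -> b i.+1 j = B (f i.+1) (f j.+1 - g j.+1).
  move=> ik jk; rewrite /b jk; case: ltnP => ik'; first by rewrite shift'.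
  by congr (B (f _) _); lia.
have fg1 : B (f 1%N - g 1%N) (f k) = 0.
  apply: opposite_sign_entry_eq0 => //.
  have <- : b 0%N k = B (f 1%N - g 1%N) (f k) by rewrite /b k0 ltnn.
  have <- : b k 0%N = B (f k) (f 1%N - g 1%N) by rewrite /b ltnn.
  apply: pascal_antidiagonal => [i j ik jk|j jk].
    rewrite bS // bS' // /b ik jk; have := oCI _ _ _ (fgC3 i.+1 ik) (fgI3 j.+1 jk).
    have gg : B (g i.+1) (g j.+1) = 0 by apply: oCI (gC2 i.+1 ik) (gI2 j.+1 jk).
    rewrite !linearBr !linearBl /= gg subr0 => /subr0_eq fg.
    by rewrite -fg; ring.
  by rewrite /b k0 jk f1f.
have g1f j : (1 <= j < k.+1)%N -> B (g 1) (f j) = 0.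
  move=> jk; have : B (f 1%N - g 1%N) (f j) = 0.
    have [->|jN] := eqVneq j k; first exact: fg1.
    by rewrite shift ?f1f //; lia.
  by rewrite linearBl /= f1f // sub0r => /eqP; rewrite oppr_eq0 => /eqP.
apply: (basis_vector_not_radical B _ (g 1) _ bV); first by case: cB.
  by rewrite !mem_cat mem_family ?orbT //; lia.
have g1k : (1 <= 1 < k.+1)%N by lia.
move=> x; rewrite !mem_cat => /or3P[] /mapP[j]; rewrite mem_index_iota => jk ->.
- by apply/herm_eq0_sym/(oCI _ _ _ (eC2 j jk) (gI2 _ g1k)).
- exact: g1f.
- exact: oCI (gC2 _ g1k) (gI2 j jk).
Qed.

(** * Coordinates and nilpotency *)

(** Indexing the dual basis by the labels of the vectors, instead of by their
    position in the list, is what allows families with shifted indices. *)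
Lemma basis_coordinates {K : fieldType} {V : vectType K} {T : eqType}
    (b : T -> V) (s : seq T) :
  uniq s -> basis_of fullv [seq b t | t <- s] ->
  exists2 crd : T -> 'Hom(V, K^o),
    (forall t u, u \in s -> crd t (b u) = (t == u)%:R)
    & (forall v, v = \sum_(t <- s) crd t v *: b t).
Proof.
move=> us bX; have [spanX freeX] := andP bX.
pose X := in_tuple [seq b t | t <- s].
pose crd t : 'Hom(V, K^o) :=
  \sum_(i < size [seq b t | t <- s])
    (i == index t s :> nat)%:R *: linfun (coord X i : V -> K^o).
have sz : size [seq b t | t <- s] = size s by rewrite size_map.
have crdE t v : crd t v = \sum_(i < size [seq b t | t <- s])
    (i == index t s :> nat)%:R * coord X i v.
  by rewrite sum_lfunE; apply: eq_bigr => i _; rewrite scale_lfunE lfunE.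
have crd_b t u : u \in s -> crd t (b u) = (t == u)%:R.
  move=> us'; have iu : (index u s < size [seq b t | t <- s])%N by rewrite sz index_mem.
  have bu : b u = X`_(Ordinal iu) by rewrite /= (nth_map u) ?index_mem // nth_index.
  rewrite crdE (bigD1 (Ordinal iu)) //= bu coord_free // eqxx mulr1.
  rewrite big1 ?addr0 => [|i iN].
    have [->|tu] := eqVneq t u; first by rewrite eqxx.
    case: eqP => [/= tu'|_]; last by [].
    have ts : t \in s by rewrite -index_mem -tu' index_mem.
    by case/eqP: tu; rewrite -(nth_index u ts) -tu' nth_index.
  by rewrite coord_free // [_ == i]eq_sym (negPf iN) mulr0.
exists crd => // v.
have vE : v = \sum_i coord X i v *: X`_i by apply: coord_basis (memvf v).
under eq_bigr do rewrite {1}vE linear_sum scaler_suml.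
rewrite {1}vE exchange_big /=; apply: eq_bigr => i _.
have /mapP[u us' ->] : X`_i \in [seq b t | t <- s] by rewrite mem_nth.
under eq_bigr do rewrite linearZ /= crd_b // -scalerA.
rewrite (bigD1_seq u) //= eqxx scale1r big1 ?addr0 // => t /negPf->.
by rewrite scale0r scaler0.
Qed.

(** n strictly lowers the rank rk of basis vectors, so that its j-th iterate
    kills every basis vector of rank less than j. *)
Lemma filtration_nilpotent {K : fieldType} {V : vectType K} {T : eqType}
    (b : T -> V) (s : seq T) (crd : T -> 'Hom(V, K^o)) (rk : T -> nat)
    (N : nat) (n : 'End(V)) :
  (forall v, v = \sum_(t <- s) crd t v *: b t) ->
  {in s, forall t, rk t < N}%N ->
  {in s &, forall t u, (rk u <= rk t)%N -> crd t (n (b u)) = 0} ->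
  forall v, iter N n v = 0.
Proof.
move=> expand rkN low.
have iter_lin j (F : T -> K) (r : seq T) :
    iter j n (\sum_(t <- r) F t *: b t) = \sum_(t <- r) F t *: iter j n (b t).
  elim: j => //= j ->; rewrite linear_sum; apply: eq_bigr => t _.
  exact: linearZ.
have kill j t : t \in s -> (rk t < j)%N -> iter j n (b t) = 0.
  elim: j t => // j IH t ts tj; rewrite iterSr (expand (n (b t))) iter_lin.
  rewrite big_seq big1 // => u us; have [uj|ju] := ltnP (rk u) j.
    by rewrite IH // scaler0.
  by rewrite low ?scale0r //; apply: leq_trans ju.
move=> v; rewrite (expand v) iter_lin big_seq big1 // => t ts.
by rewrite kill ?scaler0 ?rkN.
Qed.

Definition coordinate_system {K : fieldType} {V : vectType K}
    (e f g : nat -> V) (re r : seq nat) (ce cf cg : nat -> 'Hom(V, K^o)) :=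
  [/\ forall i j, i \in re ->
        [/\ ce j (e i) = (j == i)%:R, cf j (e i) = 0 & cg j (e i) = 0],
      forall i j, i \in r ->
        [/\ ce j (f i) = 0, cf j (f i) = (j == i)%:R & cg j (f i) = 0]
    & forall i j, i \in r ->
        [/\ ce j (g i) = 0, cf j (g i) = 0 & cg j (g i) = (j == i)%:R]].

(** The index i of e_i, f_i and g_i acts as the level of a filtration that n
    lowers; entries between different families have to follow it as well. *)
Definition strictly_triangular {K : fieldType} {V : vectType K}
    (e f g : nat -> V) (re r : seq nat) (ce cf cg : nat -> 'Hom(V, K^o))
    (n : 'End(V)) :=
  forall i j, (i <= j)%N ->
  [/\ i \in re ->
        [/\ ce j (n (e i)) = 0, cf j (n (e i)) = 0 & cg j (n (e i)) = 0],
      i \in r ->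
        [/\ ce j (n (f i)) = 0, cf j (n (f i)) = 0 & cg j (n (f i)) = 0]
    & i \in r ->
        [/\ ce j (n (g i)) = 0, cf j (n (g i)) = 0 & cg j (n (g i)) = 0]].

(** The labels are pairs of a family number and an index, and the rank of a label
    is its index. *)
Lemma three_family_coordinates {K : fieldType} {V : vectType K}
    (e f g : nat -> V) (re r : seq nat) :
  uniq re -> uniq r -> basis_of fullv (map e re ++ map f r ++ map g r) ->
  exists ce cf cg : nat -> 'Hom(V, K^o),
    coordinate_system e f g re r ce cf cg
    /\ (forall n : 'End(V), strictly_triangular e f g re r ce cf cg n ->
        exists N, forall v, iter N n v = 0).
Proof.
move=> ue ur bX.
pose b (t : nat * nat) :=
  if t.1 == 0%N then e t.2 else if t.1 == 1%N then f t.2 else g t.2.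
pose s := map (pair 0%N) re ++ map (pair 1%N) r ++ map (pair 2%N) r.
have pair_inj q : injective (@pair nat nat q) by move=> ? ? [].
have memE q q' i (l : seq nat) :
    (q, i) \in map (pair q') l = (q == q') && (i \in l).
  apply/mapP/andP => [[j jr [-> ->]]|[/eqP-> ir]]; first by [].
  by exists i.
have us : uniq s.
  rewrite !cat_uniq !map_inj_uniq ?ue ?ur //= andbT.
  apply/andP; split; apply/hasPn => -[q i]; rewrite ?mem_cat !memE.
    by case/orP=> /andP[/eqP->].
  by case/andP=> /eqP->.
have bs : basis_of fullv [seq b t | t <- s] by rewrite !map_cat -!map_comp.
have [crd crdE expand] := basis_coordinates b s us bs.
have ine i : i \in re -> (0, i)%N \in s by move=> ir; rewrite !mem_cat !memE ir.
have inf i : i \in r -> (1, i)%N \in s by move=> ir; rewrite !mem_cat !memE ir.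
have ing i : i \in r -> (2, i)%N \in s by move=> ir; rewrite !mem_cat !memE ir.
exists (fun j => crd (0, j)%N), (fun j => crd (1, j)%N), (fun j => crd (2, j)%N).
split=> [|n low].
  split=> [i j /ine ir|i j /inf ir|i j /ing ir].
  - by split; rewrite -[e i]/(b (0, i)%N) crdE.
  - by split; rewrite -[f i]/(b (1, i)%N) crdE.
  - by split; rewrite -[g i]/(b (2, i)%N) crdE.
exists (\max_(t <- s) t.2).+1.
apply: (filtration_nilpotent b s crd snd _ n expand) => [t ts|[q j] [p i]].
  by rewrite ltnS; apply: leq_bigmax_seq.
rewrite !mem_cat !memE => qj pi /= ij; have [le lf lg] := low i j ij.
have {}qj : [|| q == 0, q == 1 | q == 2]%N by case/or3P: qj => /andP[->]; rewrite ?orbT.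
by case/or3P: pi => /andP[/eqP-> ir];
  [have [] := le ir|have [] := lf ir|have [] := lg ir]; case/or3P: qj => /eqP->.
Qed.

(** Along each diagonal m is constant, and every diagonal with i <= j starts in
    the first row. *)
Lemma toeplitz_vanishing {K : fieldType} (k : nat) (m : nat -> nat -> K) :
  (forall i j, 1 <= i < k -> 1 <= j -> m i.+1 j.+1 = m i j)%N ->
  (forall j, (1 <= j)%N -> m 1%N j = 0) ->
  forall i j, (1 <= i <= k)%N -> (i <= j)%N -> m i j = 0.
Proof.
move=> toep m1; elim=> // i IH [|j] // ik ij.
have [->|i0] := posnP i; first exact: m1.
by rewrite toep ?IH //; lia.
Qed.

(** This converts the invariance of a spanned subspace into linear equations on
    the images of its generators. *)
Lemma endo_annihilator {K : fieldType} {V : vectType K} {h : 'End(V)}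
    {U : {vspace V}} (X : seq V) (phi : 'Hom(V, K^o)) v :
  (h @: U <= U)%VS -> U = <<X>>%VS -> (forall x, x \in X -> phi x = 0) ->
  v \in X -> phi (h v) = 0.
Proof.
move=> hU defU phiX vX; apply/eqP; rewrite -memv_ker.
have /subvP sub : (U <= lker phi)%VS.
  by rewrite defU; apply/span_subvP => x /phiX; rewrite memv_ker => ->.
by apply/sub/(limg_subvP h) => //; rewrite defU memv_span.
Qed.

(** * Locality of the two types *)

(** What the two types share. The invariant subspaces C_1 meet C_2,
    C_1 meet (I_2 + I_3) and I_2 are <e>, <f> and <g>, which makes n block
    diagonal; the invariance of I_3 = <f_i - g_i> identifies the blocks on f and
    on g. *)
Lemma endo_block_diagonal {K : fieldType} {V : vectType K}
    {S : sextuple V} {n : 'End(V)} {e f g : nat -> V} {re r : seq nat}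
    {ce cf cg : nat -> 'Hom(V, K^o)} :
  coordinate_system e f g re r ce cf cg -> sextuple_endo S n ->
  sextI S 1 = <<map g r>>%VS ->
  sextI S 2 = <<[seq f i - g i | i <- r]>>%VS ->
  sextC S 0 = <<map e re ++ map f r>>%VS ->
  sextC S 1 = <<map e re ++ map g r>>%VS ->
  [/\ forall i j, i \in re -> cf j (n (e i)) = 0 /\ cg j (n (e i)) = 0,
      forall i j, i \in r -> ce j (n (f i)) = 0 /\ cg j (n (f i)) = 0,
      forall i j, i \in r -> ce j (n (g i)) = 0 /\ cf j (n (g i)) = 0
    & forall i j, i \in r -> cf j (n (f i)) = cg j (n (g i))].
Proof.
case=> cE cF cG nS I2 I3 C1 C2.
have [nI nC] : (forall i, n @: sextI S i <= sextI S i)%VS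
  /\ (forall i, n @: sextC S i <= sextC S i)%VS by split=> i; case: (nS i).
have nC1 j v : v \in map e re ++ map f r -> cg j (n v) = 0.
  apply: endo_annihilator (nC 0) C1 _ => x; rewrite mem_cat.
  by case/orP=> /mapP[i ir ->]; [case: (cE i j ir)|case: (cF i j ir)].
have nC2 j v : v \in map e re ++ map g r -> cf j (n v) = 0.
  apply: endo_annihilator (nC 1) C2 _ => x; rewrite mem_cat.
  by case/orP=> /mapP[i ir ->]; [case: (cE i j ir)|case: (cG i j ir)].
have ce_g i j : i \in r -> ce j (n (g i)) = 0.
  move=> ir; apply: endo_annihilator (nI 1) I2 _ (map_f _ ir) => x.
  by case/mapP=> i' ir' ->; case: (cG i' j ir').
have nI3 (phi : 'Hom(V, K^o)) i : i \in r ->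
    {in r, forall i', phi (f i') = phi (g i')} -> phi (n (f i)) = phi (n (g i)).
  move=> ir phi_fg; apply: subr0_eq; rewrite -!linearB.
  apply: endo_annihilator (nI 2) I3 _ (map_f (fun i => f i - g i) ir) => x.
  by case/mapP=> i' ir' ->; rewrite linearB /= phi_fg // subrr.
have ce_f i j : i \in r -> ce j (n (f i)) = 0.
  move=> ir; rewrite nI3 ?ce_g // => i' ir'.
  by have [-> _ _] := cF i' j ir'; have [-> _ _] := cG i' j ir'.
have cg_f i j : i \in r -> cg j (n (f i)) = 0.
  by move=> ir; apply: nC1; rewrite mem_cat map_f ?orbT.
have cf_g i j : i \in r -> cf j (n (g i)) = 0.
  by move=> ir; apply: nC2; rewrite mem_cat map_f ?orbT.
split=> i j ir; try by split; auto.
  by split; [apply: nC2|apply: nC1]; rewrite mem_cat map_f.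
have : (cf j + cg j) (n (f i)) = (cf j + cg j) (n (g i)).
  apply: nI3 => // i' ir'; have [_ ff fg] := cF i' j ir'.
  by have [_ gf gg] := cG i' j ir'; rewrite !add_lfunE ff fg gf gg add0r addr0.
by rewrite !add_lfunE cg_f // cf_g // addr0 add0r.
Qed.

(** The scalar is the entry m_(1,1), the coefficient of e_1 in h(e_1); subtracting
    it makes the whole first row of the Toeplitz matrix vanish. *)
Lemma local_3kp1 {K : fieldType} {V : vectType K} (k : nat) (S : sextuple V) :
  type_A_3kp1 k S -> local_sextuple S.
Proof.
move=> [e [f [g]]] [bV [I1 I2 I3] [C1 C2 C3]] h hS.
have [ce [cf [cg [crd nilp]]]] := three_family_coordinates e f g
  (index_iota 1 k.+2) (index_iota 1 k.+1) (iota_uniq _ _) (iota_uniq _ _) bV.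
exists (ce 1%N (h (e 1%N))); apply: nilp.
move nE: (h - ce 1%N (h (e 1%N)) *: \1)%VF => n.
have nS : sextuple_endo S n by rewrite -nE; apply: sextuple_endo_shift.
have [n_e n_f n_g cf_cg] := endo_block_diagonal crd nS I2 I3 C1 C2.
have [cE cF cG] := crd.
have wide i : i \in index_iota 1 k.+1 -> i \in index_iota 1 k.+2.
  by rewrite !mem_index_iota; lia.
have shift i : i \in index_iota 1 k.+1 -> i.+1 \in index_iota 1 k.+2.
  by rewrite !mem_index_iota; lia.
have e1 : 1%N \in index_iota 1 k.+2 by [].
have ce_cf i j : i \in index_iota 1 k.+1 -> ce j (n (e i)) = cf j (n (f i)).
  move=> ir; apply: subr0_eq; have : (ce j + cf j) (n (e i - f i)) = 0.
    apply: endo_annihilator (nS 0).1 I1 _ (map_f (fun i => e i - f i) ir) => x.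
    case/mapP=> i' ir' ->; have [fe ff _] := cF i' j ir'.
    have [ee ef _] := cE i' j (wide _ ir').
    by rewrite add_lfunE !linearB /= ff fe ee ef subr0 sub0r subrr.
  rewrite add_lfunE !linearB /=.
  by rewrite (n_f i j ir).1 (n_e i j (wide _ ir)).1 subr0 sub0r.
(* The functionals ce_(j+1) + cf_j + cg_j are the equations of C_3. *)
have nC3 j v : (1 <= j)%N ->
    v \in e 1%N :: [seq e i.+1 - f i | i <- index_iota 1 k.+1]
                ++ [seq f i - g i | i <- index_iota 1 k.+1] ->
    (ce j.+1 + cf j + cg j) (n v) = 0.
  move=> j1; apply: endo_annihilator (nS 2).2 C3 _ => x.
  rewrite in_cons mem_cat !add_lfunE.
  case/or3P=> [/eqP->|/mapP[i ir ->]|/mapP[i ir ->]].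
  - have [_ -> ->] := cE 1%N j e1; have [-> _ _] := cE 1%N j.+1 e1.
    by case: j j1 => // j _; rewrite !addr0.
  - have [_ ef eg] := cE i.+1 j (shift _ ir).
    have [ee _ _] := cE i.+1 j.+1 (shift _ ir).
    have [_ ff fg] := cF i j ir; have [fe _ _] := cF i j.+1 ir.
    by rewrite !linearB /= ef eg ee ff fg fe eqSS !subr0 sub0r addr0 subrr.
  - have [ge _ _] := cG i j.+1 ir; have [_ gf gg] := cG i j ir.
    have [_ ff fg] := cF i j ir; have [fe _ _] := cF i j.+1 ir.
    by rewrite !linearB /= ge gf gg ff fg fe !subr0 add0r sub0r subrr.
pose m i j := ce j (n (e i)).
have m_toep i j : (1 <= i < k.+1)%N -> (1 <= j)%N -> m i.+1 j.+1 = m i j.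
  rewrite -mem_index_iota => ir j1; apply: subr0_eq.
  have := nC3 j (e i.+1 - f i) j1; rewrite !add_lfunE !linearB /=.
  have [-> ->] := n_e i.+1 j (shift _ ir); have [_ ->] := n_f i j ir.
  have [-> _] := n_f i j.+1 ir; rewrite !subr0 sub0r addr0 /m (ce_cf i j) //.
  by apply; rewrite in_cons mem_cat (map_f (fun i => e i.+1 - f i)) ?orbT.
have m_1 j : (1 <= j)%N -> m 1%N j = 0.
  case: j => [|[|j]] // _; last first.
    have := nC3 j.+1 (e 1%N) isT (mem_head _ _).
    by rewrite !add_lfunE; have [-> ->] := n_e 1%N j.+1 e1; rewrite !addr0.
  rewrite /m -nE add_lfunE opp_lfunE scale_lfunE id_lfunE linearB linearZ /=.
  by have [-> _ _] := cE 1%N 1%N e1; rewrite [_ *: _]mulr1 subrr.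
have m0 i j : i \in index_iota 1 k.+2 -> (i <= j)%N -> ce j (n (e i)) = 0.
  by rewrite mem_index_iota; apply: toeplitz_vanishing m_toep m_1 i j.
move=> i j ij; split=> ir.
- by have [-> ->] := n_e i j ir; rewrite m0.
- by have [-> ->] := n_f i j ir; rewrite -ce_cf // m0 ?wide.
- by have [-> ->] := n_g i j ir; rewrite -cf_cg // -ce_cf // m0 ?wide.
Qed.

(** Since e_1 is missing, the Toeplitz matrix is read off on the f family; the
    generator f_1 of I_1 gives its first row. *)
Lemma local_3km1 {K : fieldType} {V : vectType K} (k : nat) (S : sextuple V) :
  (0 < k)%N -> type_A_3km1 k S -> local_sextuple S.
Proof.
move=> k0 [e [f [g]]] [bV [I1 I2 I3] [C1 C2 C3]] h hS.
have [ce [cf [cg [crd nilp]]]] := three_family_coordinates e f g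
  (index_iota 2 k.+1) (index_iota 1 k.+1) (iota_uniq _ _) (iota_uniq _ _) bV.
exists (cf 1%N (h (f 1%N))); apply: nilp.
move nE: (h - cf 1%N (h (f 1%N)) *: \1)%VF => n.
have nS : sextuple_endo S n by rewrite -nE; apply: sextuple_endo_shift.
have [n_e n_f n_g cf_cg] := endo_block_diagonal crd nS I2 I3 C1 C2.
have [cE cF cG] := crd.
have wide i : i \in index_iota 2 k.+1 -> i \in index_iota 1 k.+1.
  by rewrite !mem_index_iota; lia.
have narrow i : i \in index_iota 1 k -> i \in index_iota 1 k.+1.
  by rewrite !mem_index_iota; lia.
have shift i : i \in index_iota 1 k -> i.+1 \in index_iota 2 k.+1.
  by rewrite !mem_index_iota; lia.
have f1 : 1%N \in index_iota 1 k.+1 by rewrite mem_index_iota; lia.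
have nI1 j v : (2 <= j)%N ->
    v \in f 1%N :: [seq f i - e i | i <- index_iota 2 k.+1] ->
    (ce j + cf j) (n v) = 0.
  move=> j2; apply: endo_annihilator (nS 0).1 I1 _ => x.
  rewrite in_cons add_lfunE => /predU1P[->|/mapP[i ir ->]].
    have [-> -> _] := cF 1%N j f1; rewrite add0r.
    by case: j j2 => [|[|j]].
  have [fe ff _] := cF i j (wide _ ir); have [ee ef _] := cE i j ir.
  by rewrite !linearB /= fe ff ee ef subr0 sub0r addrC subrr.
have ce_cf i j : i \in index_iota 2 k.+1 -> (2 <= j)%N ->
    ce j (n (e i)) = cf j (n (f i)).
  move=> ir j2; apply/esym/subr0_eq.
  have := nI1 j (f i - e i) j2; rewrite add_lfunE !linearB /=.
  have [-> _] := n_e i j ir; have [-> _] := n_f i j (wide _ ir).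
  rewrite subr0 sub0r [- ce _ _ + _]addrC.
  by apply; rewrite in_cons (map_f (fun i => f i - e i)) ?orbT.
(* Again equations of C_3, since f_i - e_(i+1) has opposite coordinates at f_i
   and at e_(i+1). *)
have nC3 j v : (1 <= j)%N ->
    v \in [seq f i - e i.+1 | i <- index_iota 1 k]
          ++ [seq f i - g i | i <- index_iota 1 k.+1] ->
    (ce j.+1 + cf j + cg j) (n v) = 0.
  move=> j1; apply: endo_annihilator (nS 2).2 C3 _ => x.
  rewrite mem_cat !add_lfunE => /orP[/mapP[i ir ->]|/mapP[i ir ->]].
  - have [_ ef eg] := cE i.+1 j (shift _ ir).
    have [ee _ _] := cE i.+1 j.+1 (shift _ ir).
    have [_ ff fg] := cF i j (narrow _ ir).
    have [fe _ _] := cF i j.+1 (narrow _ ir).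
    by rewrite !linearB /= ef eg ee ff fg fe eqSS !subr0 sub0r addr0 addrC subrr.
  - have [ge _ _] := cG i j.+1 ir; have [_ gf gg] := cG i j ir.
    have [_ ff fg] := cF i j ir; have [fe _ _] := cF i j.+1 ir.
    by rewrite !linearB /= ge gf gg ff fg fe !subr0 add0r sub0r subrr.
pose m i j := cf j (n (f i)).
have m_toep i j : (1 <= i < k)%N -> (1 <= j)%N -> m i.+1 j.+1 = m i j.
  rewrite -mem_index_iota => ir j1; apply/esym/subr0_eq.
  have := nC3 j (f i - e i.+1) j1; rewrite !add_lfunE !linearB /=.
  have [-> ->] := n_e i.+1 j (shift _ ir); have [_ ->] := n_f i j (narrow _ ir).
  have [-> _] := n_f i j.+1 (narrow _ ir); rewrite !subr0 sub0r addr0 [- ce _ _ + _]addrC.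
  rewrite /m -(ce_cf i.+1 j.+1) ?shift //.
  by apply; rewrite mem_cat (map_f (fun i => f i - e i.+1)).
have m_1 j : (1 <= j)%N -> m 1%N j = 0.
  case: j => [|[|j]] // _; last first.
    have := nI1 j.+2 (f 1%N) isT (mem_head _ _).
    by rewrite add_lfunE; have [-> _] := n_f 1%N j.+2 f1; rewrite add0r.
  rewrite /m -nE add_lfunE opp_lfunE scale_lfunE id_lfunE linearB linearZ /=.
  by have [_ -> _] := cF 1%N 1%N f1; rewrite [_ *: _]mulr1 subrr.
have m0 i j : i \in index_iota 1 k.+1 -> (i <= j)%N -> cf j (n (f i)) = 0.
  by rewrite mem_index_iota; apply: toeplitz_vanishing m_toep m_1 i j.
move=> i j ij; split=> ir.
- have [-> ->] := n_e i j ir; rewrite ce_cf ?m0 ?wide //.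
  by move: ir; rewrite mem_index_iota; lia.
- by have [-> ->] := n_f i j ir; rewrite m0.
- by have [-> ->] := n_g i j ir; rewrite -cf_cg // m0.
Qed.

Lemma dim_gt0_of_basis {K : fieldType} {V : vectType K} (X : seq V) :
  basis_of fullv X -> (0 < size X)%N -> (0 < dim V)%N.
Proof. by case/andP=> /eqP spanX /eqP <-; rewrite spanX dimvf. Qed.

(** * Compatible forms on the two types *)

Theorem theorem5p9 (K : fieldType) (Kperfect : perfect_field K)
    (Kchar : 2%N \notin [pchar K]) (V : vectType K) (k : nat) (S : sextuple V)
    (hS : type_A_3kp1 k S \/ ((1 <= k)%N /\ type_A_3km1 k S)) :
  [/\ (forall B1 B2 : {hermitian V for odd k & idfun},
         compatible S B1 -> compatible S B2 ->
         exists c : K, exists eta : 'End(V),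
           [/\ c != 0, sextuple_aut S eta
             & forall x y, B2 x y = c * B1 (eta x) (eta y)]),
      (forall B : {hermitian V for odd k.+1 & idfun}, ~ compatible S B)
    & (forall (eps : bool) (B : {hermitian V for eps & idfun}) (c : K),
         compatible S B -> c != 0 ->
         ((exists eta : 'End(V),
             sextuple_aut S eta /\
             forall x y, B (eta x) (eta y) = c * B x y)
          <-> exists d : K, c = d ^+ 2))].
Proof.
have V0 : (0 < dim V)%N.
  case: hS => [|[k0]] [e [f [g [bV _ _]]]]; apply: dim_gt0_of_basis bV _.
    by rewrite size_cat size_map size_iota; lia.
  by rewrite !size_cat !size_map !size_iota; lia.
have locS : local_sextuple S.
  by case: hS => [|[k0]]; [apply: local_3kp1|apply: local_3km1 k0].
split=> [B1 B2|B|eps B c].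
- exact: compatible_form_unique.
- by case: hS => [|[k0]]; [apply: no_compatible_3kp1|apply: no_compatible_3km1].
- exact: compatible_similitude.
Qed.
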